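(* Any finite correspondence Hopf algebra is a finite group $G$ with a unique factorization $G=G_+G_-$, in the following sense. Let $G$ be a finite set carrying the structure of a correspondence Hopf algebra with multiplication $m\subset (G\times G)\times G$, comultiplication $\Delta\subset G\times(G\times G)$, unit $1\subset\{pt\}\times G$, counit $\epsilon\subset G\times\{pt\}$ and antipode $S\subset G\times G$. Then $G$ carries a group structure and has subgroups $G_+,G_-$ such that every element of $G$ can be written uniquely as $g_+g_-$ with $g_+\in G_+$, $g_-\in G_-$, and such that $$m=\{(g_-h_+,\,h_+k_-,\,g_-h_+k_-): h_+\in G_+,\ g_-,k_-\in G_-\},$$ $$\Delta=\{(g_+h_-k_+,\,g_+h_-,\,h_-k_+): g_+,k_+\in G_+,\ h_-\in G_-\},$$ $$1=\{(pt,g_+): g_+\in G_+\},\qquad \epsilon=\{(g_-,pt): g_-\in G_-\},\qquad S=\{(g,g^{-1}): g\in G\}.$$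
   Context: All sets are finite. A correspondence from a set $X$ to a set $Y$ is a subset $F\subset X\times Y$. The composition of a correspondence $F$ from $X$ to $Y$ followed by a correspondence $G$ from $Y$ to $Z$ is the correspondence from $X$ to $Z$ given by $\{(x,z): \text{there is } y\in Y \text{ with } (x,y)\in F \text{ and } (y,z)\in G\}$. With correspondences as morphisms, finite sets form the correspondence category. The identity morphism of $X$ is the diagonal $\{(x,x):x\in X\}\subset X\times X$. This is a (symmetric) monoidal category, with the Cartesian product of sets (and of correspondences) as tensor product and a one point set $\{pt\}$ as identity object. An algebra in this category is a monoid object (associative multiplication $m$ with a two-sided unit $1$), a coalgebra is a comonoid object (coassociative comultiplication $\Delta$ with a counit $\epsilon$). A correspondence bialgebra consists of an algebra structure and a coalgebra structure on the same set such that the coalgebra structure maps ($\Delta$ and $\epsilon$) are algebra morphisms. A correspondence Hopf algebra is a correspondence bialgebra with an antipode $S$, i.e. a morphism making the usual antipode diagrams commute: $m\circ(S\otimes\mathrm{id})\circ\Delta=1\circ\epsilon=m\circ(\mathrm{id}\otimes S)\circ\Delta$ (here written in the usual right-to-left order of composition). *)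

(* Defs.v *)
From HB Require Import structures.
#[warnings="-notation-overridden"] From mathcomp Require Import all_boot all_fingroup.

Set Implicit Arguments.
Unset Strict Implicit.
Unset Printing Implicit Defensive.

Definition corr (X Y : finType) := {set X * Y}.

Section Category.
Variables X Y Z X' Y' : finType.

(* Diagrammatic order: F is followed by G. *)
Definition corr_comp (F : corr X Y) (G : corr Y Z) : corr X Z :=
  [set p | [exists y, ((p.1, y) \in F) && ((y, p.2) \in G)]].

Definition corr_id : corr X X := [set p | p.1 == p.2].

Definition corr_tensor (F : corr X Y) (G : corr X' Y') :
    corr (X * X')%type (Y * Y')%type :=
  [set p | ((p.1.1, p.2.1) \in F) && ((p.1.2, p.2.2) \in G)].

(* Turns the structural bijections of the Cartesian product into morphisms. *)
Definition corr_graph (f : X -> Y) : corr X Y := [set p | p.2 == f p.1].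

End Category.

Arguments corr_id X : clear implicits.

Declare Scope corr_scope.
Delimit Scope corr_scope with corr.
Notation "F ;; G" := (corr_comp F G)
  (at level 50, left associativity) : corr_scope.
Notation "F ** G" := (corr_tensor F G)
  (at level 40, left associativity) : corr_scope.
Local Open Scope corr_scope.

Definition corr_assoc (X Y Z : finType) :
    corr (X * Y * Z)%type (X * (Y * Z))%type :=
  corr_graph (fun p => (p.1.1, (p.1.2, p.2))).

Definition corr_unitl (X : finType) : corr (unit * X)%type X := corr_graph snd.

Definition corr_unitr (X : finType) : corr (X * unit)%type X := corr_graph fst.

Definition corr_unitl_inv (X : finType) : corr X (unit * X)%type :=
  corr_graph (fun x => (tt, x)).

Definition corr_unitr_inv (X : finType) : corr X (X * unit)%type :=
  corr_graph (fun x => (x, tt)).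

(* The symmetry applied to the two middle factors. *)
Definition corr_interchange (X Y Z W : finType) :
    corr (X * Y * (Z * W))%type (X * Z * (Y * W))%type :=
  corr_graph (fun p => ((p.1.1, p.2.1), (p.1.2, p.2.2))).

Definition is_corr_algebra (A : finType)
    (m : corr (A * A)%type A) (e : corr unit A) : Prop :=
  [/\ (m ** corr_id A) ;; m = corr_assoc A A A ;; (corr_id A ** m) ;; m,
      (e ** corr_id A) ;; m = corr_unitl A
    & (corr_id A ** e) ;; m = corr_unitr A].

Definition is_corr_coalgebra (A : finType)
    (Delta : corr A (A * A)%type) (eps : corr A unit) : Prop :=
  [/\ Delta ;; (Delta ** corr_id A) ;; corr_assoc A A A
        = Delta ;; (corr_id A ** Delta),
      Delta ;; (eps ** corr_id A) = corr_unitl_inv A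
    & Delta ;; (corr_id A ** eps) = corr_unitr_inv A].

Definition is_corr_algebra_morphism (A B : finType)
    (mA : corr (A * A)%type A) (eA : corr unit A)
    (mB : corr (B * B)%type B) (eB : corr unit B) (F : corr A B) : Prop :=
  mA ;; F = (F ** F) ;; mB /\ eA ;; F = eB.

(* The algebra structure of the monoidal unit, the target of eps. *)
Definition corr_unit_mul : corr (unit * unit)%type unit := corr_unitl unit.
Definition corr_unit_one : corr unit unit := corr_id unit.

Definition corr_tensor_mul (A B : finType)
    (mA : corr (A * A)%type A) (mB : corr (B * B)%type B) :
    corr (A * B * (A * B))%type (A * B)%type :=
  corr_interchange A B A B ;; (mA ** mB).

Definition corr_tensor_one (A B : finType)
    (eA : corr unit A) (eB : corr unit B) : corr unit (A * B)%type :=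
  corr_unitl_inv unit ;; (eA ** eB).

Definition is_corr_bialgebra (A : finType)
    (m : corr (A * A)%type A) (e : corr unit A)
    (Delta : corr A (A * A)%type) (eps : corr A unit) : Prop :=
  [/\ is_corr_algebra m e,
      is_corr_coalgebra Delta eps,
      is_corr_algebra_morphism
        m e (corr_tensor_mul m m) (corr_tensor_one e e) Delta
    & is_corr_algebra_morphism m e corr_unit_mul corr_unit_one eps].

Definition is_corr_antipode (A : finType)
    (m : corr (A * A)%type A) (e : corr unit A)
    (Delta : corr A (A * A)%type) (eps : corr A unit) (S : corr A A) : Prop :=
  Delta ;; (S ** corr_id A) ;; m = eps ;; e /\
  Delta ;; (corr_id A ** S) ;; m = eps ;; e.

Definition is_corr_hopf_algebra (A : finType)
    (m : corr (A * A)%type A) (e : corr unit A)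
    (Delta : corr A (A * A)%type) (eps : corr A unit) (S : corr A A) : Prop :=
  is_corr_bialgebra m e Delta eps /\ is_corr_antipode m e Delta eps S.

Definition group_structure (A : finType) : Type := isGroup A.

(* The finGroupType whose carrier is A itself. Its Finite structure agrees with
   that of A only up to eta, so sets over A and over finGroup_of law have
   distinct types although their elements have the same type. *)
Definition finGroup_of (A : finType) (law : group_structure A) : finGroupType :=
  HB.pack (Finite.sort A) (law : isGroup A).

Definition unique_factorization (gT : finGroupType) (Gp Gm : {group gT}) : Prop :=
  forall g : gT,
    exists! p : gT * gT, [/\ p.1 \in Gp, p.2 \in Gm & g = (p.1 * p.2)%g].

(* Main.v *)
Require Import Defs.
From mathcomp Require Import all_boot all_fingroup.

(** The elements of [G] are read as squares of a double category. Write
    [hm x y z] when [z] is one of the values of the product of [x] and [y], and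
    [vm x y z] when [(x, y)] is one of the coproducts of [z]: [hm] pastes [x] to
    the left of [y], [vm] pastes [x] above [y]. The unit [e] and the counit
    [eps] become the sets [hu] and [vu] of horizontal and vertical identities.
    The unit laws give every square a unique [left] and [right] edge in [hu] and
    a unique [top] and [bottom] edge in [vu], and compatibility of [Delta] with
    [m] says that the edges of a pasting are the pastings of the edges. The
    Hopf axioms are stable under exchanging [m] with [Delta] and under reversing
    both, so each fact about one edge yields the same fact about all four.

    The antipode supplies all the rigidity. For [s] in [vu] and [t] in [hu] the
    second antipode axiom produces [a], [b], [b'] with [vm a b s], [an b b'] and
    [hm a b' t], so that [a] has top [s] and left edge [t]. If [w] is any square
    with these edges, associativity lets [w] be written as [a] above some [u] in
    the product [b] above [w], while [b'] beside [w] is defined; the first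
    antipode axiom then forces [u] into [vu], hence [w = a] ([corner_unique]).
    Thus a square is determined by its top and left edges, which are arbitrary.
    It follows that every square has horizontal and vertical inverses, that both
    pastings are single valued and defined as soon as the common edges agree,
    and that any two adjacent edges also determine a square
    ([left_bottom_inj], [left_bottom_exists]).

    In particular [vu] and [hu] are groups, and completing a left edge [p] and a
    bottom edge [n] to a square [c] gives an exchange rule [p n = n' p'], where
    [n'] and [p'] are the top and right edges of [c]. Pasting of squares makes
    this a matched pair of groups, so that [G], in the coordinates
    [(top, right)], is a Zappa-Szep product. In this group
    [x = top x * right x = left x * bottom x], a horizontal pasting is
    [top x * y], a vertical one is [left x * y] ([hmE], [vmE]), and the antipode
    relates [a] to [b] exactly when [b] is inverse to [a] ([anE]). *)

Set Implicit Arguments.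
Unset Strict Implicit.
Unset Printing Implicit Defensive.

(** * Correspondence Hopf algebras as squares with two pastings *)

(** The operations are relations because both pastings are multivalued and
    partial at this stage. The element [one], common to [hu] and [vu], witnesses
    that [eps] preserves the unit; as a field it is shared, up to conversion, by
    all symmetric images of the structure. *)
Record hopf (A : finType) := Hopf {
  hm : A -> A -> A -> bool;
  vm : A -> A -> A -> bool;
  hu : pred A;
  vu : pred A;
  an : rel A;
  one : A;
  hm_assoc : forall x y z w,
    (exists u, hm x y u /\ hm u z w) <-> (exists v, hm y z v /\ hm x v w);
  vm_assoc : forall x y z w,
    (exists u, vm x y u /\ vm u z w) <-> (exists v, vm y z v /\ vm x v w);
  hm_unitl : forall x y, (exists u, hu u /\ hm u x y) <-> x = y;
  hm_unitr : forall x y, (exists u, hu u /\ hm x u y) <-> x = y;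
  vm_unitl : forall x y, (exists u, vu u /\ vm u x y) <-> x = y;
  vm_unitr : forall x y, (exists u, vu u /\ vm x u y) <-> x = y;
  interchange : forall x y p q, (exists z, hm x y z /\ vm p q z) <->
    (exists x1 x2 y1 y2, [/\ vm x1 x2 x, vm y1 y2 y, hm x1 y1 p & hm x2 y2 q]);
  vm_hu : forall p q, (exists z, hu z /\ vm p q z) <-> hu p /\ hu q;
  hm_vu : forall x y, (exists z, vu z /\ hm x y z) <-> vu x /\ vu y;
  hu_one : hu one;
  vu_one : vu one;
  antipodel : forall x y,
    (exists a b a', [/\ vm a b x, an a a' & hm a' b y]) <-> vu x /\ hu y;
  antipoder : forall x y,
    (exists a b b', [/\ vm a b x, an b b' & hm a b' y]) <-> vu x /\ hu y
}.

(** Reflection of the squares in the diagonal: product and coproduct are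
    exchanged, and the antipode axioms persist for the converse relation. *)
Program Definition transpose A (D : hopf A) : hopf A := {|
  hm := vm D; vm := hm D; hu := vu D; vu := hu D;
  an := fun a b => an D b a; one := one D;
  hm_assoc := vm_assoc D; vm_assoc := hm_assoc D;
  hm_unitl := vm_unitl D; hm_unitr := vm_unitr D;
  vm_unitl := hm_unitl D; vm_unitr := hm_unitr D;
  vm_hu := hm_vu D; hm_vu := vm_hu D;
  hu_one := vu_one D; vu_one := hu_one D |}.
Next Obligation.
move=> A D x y p q; split.
  move=> [z [xyz pqz]].
  have /interchange[x1 [x2 [y1 [y2 [? ? ? ?]]]]] :
    exists z, hm D p q z /\ vm D x y z by exists z.
  by exists x1, y1, x2, y2.
move=> [x1 [x2 [y1 [y2 [? ? ? ?]]]]].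
have /interchange[z [? ?]] : exists x1 x2 y1 y2,
  [/\ vm D x1 x2 p, vm D y1 y2 q, hm D x1 y1 x & hm D x2 y2 y].
  by exists x1, y1, x2, y2.
by exists z.
Qed.
Next Obligation.
move=> A D x y; split=> [[a [b [a' [? ? ?]]]]|[xU yV]].
  suff: vu D y /\ hu D x by case.
  by apply/(antipodel D); exists a', b, a.
have /(antipodel D)[a [b [a' [? ? ?]]]] := conj yV xU.
by exists a', b, a.
Qed.
Next Obligation.
move=> A D x y; split=> [[a [b [b' [? ? ?]]]]|[xU yV]].
  suff: vu D y /\ hu D x by case.
  by apply/(antipoder D); exists a, b', b.
have /(antipoder D)[a [b [b' [? ? ?]]]] := conj yV xU.
by exists a, b', b.
Qed.

(** The opposite product together with the opposite coproduct: rotation by a half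
    turn, which exchanges the two antipode axioms. *)
Program Definition reverse A (D : hopf A) : hopf A := {|
  hm := fun x y => hm D y x; vm := fun x y => vm D y x;
  hu := hu D; vu := vu D; an := an D; one := one D;
  hm_unitl := hm_unitr D; hm_unitr := hm_unitl D;
  vm_unitl := vm_unitr D; vm_unitr := vm_unitl D;
  hu_one := hu_one D; vu_one := vu_one D |}.
Next Obligation. by move=> A D x y z w; exact: (iff_sym (hm_assoc D z y x w)). Qed.
Next Obligation. by move=> A D x y z w; exact: (iff_sym (vm_assoc D z y x w)). Qed.
Next Obligation.
move=> A D x y p q; apply: iff_trans (interchange D y x q p) _.
by split=> -[x1 [x2 [y1 [y2 [? ? ? ?]]]]]; exists y2, y1, x2, x1.
Qed.
Next Obligation.
by move=> A D p q; exact: (iff_trans (vm_hu D q p) (and_comm _ _)).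
Qed.
Next Obligation.
by move=> A D p q; exact: (iff_trans (hm_vu D q p) (and_comm _ _)).
Qed.
Next Obligation.
move=> A D x y; apply: iff_trans (antipoder D x y).
by split=> -[a [b [c [? ? ?]]]]; exists b, a, c.
Qed.
Next Obligation.
move=> A D x y; apply: iff_trans (antipodel D x y).
by split=> -[a [b [c [? ? ?]]]]; exists b, a, c.
Qed.

(** * Edges of a square *)

(** The four edges are the left edge of [D] seen through its symmetries. As
    [left] uses only the relations of [D], never its axioms, the edges of
    [transpose D] and [reverse D] are convertible to edges of [D], and a lemma
    about [left] gives its three mirror images by conversion. *)
Definition left A (D : hopf A) x := odflt x [pick u | hu D u && hm D u x x].
Definition right A (D : hopf A) := left (reverse D).
Definition top A (D : hopf A) := left (transpose D).
Definition bottom A (D : hopf A) := left (reverse (transpose D)).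


Lemma hu_left_hm A (D : hopf A) x : hu D (left D x) /\ hm D (left D x) x x.
Proof.
rewrite /left; case: pickP => [u /andP[]//|nou].
have /(hm_unitl D)[u [uU uxx]] : x = x by [].
by have := nou u; rewrite uU uxx.
Qed.

Section Horizontal.
Variables (A : finType) (D : hopf A).
Local Notation hm := (hm D).
Local Notation vm := (vm D).
Local Notation hu := (hu D).
Local Notation vu := (vu D).
Local Notation an := (an D).
Local Notation left := (left D).
Local Notation right := (right D).
Local Notation top := (top D).
Local Notation bottom := (bottom D).
Local Notation one := (one D).

Lemma hu_left x : hu (left x). Proof. by case: (hu_left_hm D x). Qed.
Lemma hm_left x : hm (left x) x x. Proof. by case: (hu_left_hm D x). Qed.
Lemma hu_right x : hu (right x). Proof. by case: (hu_left_hm (reverse D) x). Qed.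
Lemma hm_right x : hm x (right x) x. Proof. by case: (hu_left_hm (reverse D) x). Qed.

Lemma hm_unitl_eq u x y : hu u -> hm u x y -> y = x.
Proof. by move=> uU uxy; apply/esym/(hm_unitl D); exists u. Qed.

Lemma hm_unitr_eq u x y : hu u -> hm x u y -> y = x.
Proof. by move=> uU uxy; apply/esym/(hm_unitr D); exists u. Qed.

(** If [u] is a left identity of [x], then [left x] and [u] have a common value
    because the iterated product with [x] is nonempty; being identities, both
    equal that value. *)
Lemma left_unique u x : hu u -> hm u x x -> left x = u.
Proof.
move=> uU uxx; have [v [luv _]] : exists v, hm (left x) u v /\ hm v x x.
  by apply/(hm_assoc D); exists x; split=> //; apply: hm_left.
by rewrite -(hm_unitr_eq uU luv) (hm_unitl_eq (hu_left x) luv).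
Qed.

Lemma left_unit u : hu u -> left u = u.
Proof.
by move=> uU; apply/esym/(hm_unitr_eq uU (hm_left u)).
Qed.

Lemma left_hm x y z : hm x y z -> left z = left x.
Proof.
move=> xyz; apply: left_unique; first exact: hu_left.
have [v [_ lvz]] : exists v, hm x y v /\ hm (left x) v z.
  by apply/(hm_assoc D); exists x; split=> //; apply: hm_left.
by rewrite {1}(hm_unitl_eq (hu_left x) lvz).
Qed.

(** The square [z] is a pasting of [left z] and [z], and also of [p] above [q].
    The interchange law cuts it into four squares, the left two of which are
    identities, as they compose vertically to [left z]. *)
Lemma left_vm p q z : vm p q z -> vm (left p) (left q) (left z).
Proof.
move=> pqz.
have /(interchange D)[x1 [x2 [y1 [y2 [xl xz xp xq]]]]] :
  exists w, hm (left z) z w /\ vm p q w by exists z; split=> //; apply: hm_left.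
have [x1U x2U] : hu x1 /\ hu x2.
  by apply/(vm_hu D); exists (left z); split=> //; apply: hu_left.
by rewrite (left_hm xp) (left_hm xq) (left_unit x1U) (left_unit x2U).
Qed.

End Horizontal.

Section Edges.
Variables (A : finType) (D : hopf A).
Local Notation hm := (hm D).
Local Notation vm := (vm D).
Local Notation hu := (hu D).
Local Notation vu := (vu D).
Local Notation an := (an D).
Local Notation left := (left D).
Local Notation right := (right D).
Local Notation top := (top D).
Local Notation bottom := (bottom D).
Local Notation one := (one D).

Lemma vu_top x : vu (top x). Proof. exact: (hu_left (transpose D)). Qed.
Lemma vu_bottom x : vu (bottom x). Proof. exact: (hu_right (transpose D)). Qed.
Lemma vm_top x : vm (top x) x x. Proof. exact: (hm_left (transpose D)). Qed.

Lemma right_unit u : hu u -> right u = u.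
Proof. exact: (@left_unit _ (reverse D)). Qed.
Lemma top_unit u : vu u -> top u = u.
Proof. exact: (@left_unit _ (transpose D)). Qed.
Lemma bottom_unit u : vu u -> bottom u = u.
Proof. exact: (@left_unit _ (reverse (transpose D))). Qed.

Lemma right_hm x y z : hm x y z -> right z = right y.
Proof. exact: (@left_hm _ (reverse D)). Qed.
Lemma top_vm x y z : vm x y z -> top z = top x.
Proof. exact: (@left_hm _ (transpose D)). Qed.
Lemma bottom_vm x y z : vm x y z -> bottom z = bottom y.
Proof. exact: (@left_hm _ (reverse (transpose D))). Qed.

Lemma right_vm x y z : vm x y z -> vm (right x) (right y) (right z).
Proof. exact: (@left_vm _ (reverse D)). Qed.
Lemma top_hm x y z : hm x y z -> hm (top x) (top y) (top z).
Proof. exact: (@left_vm _ (transpose D)). Qed.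
Lemma bottom_hm x y z : hm x y z -> hm (bottom x) (bottom y) (bottom z).
Proof. exact: (@left_vm _ (reverse (transpose D))). Qed.

Lemma hm_match x y z : hm x y z -> right x = left y.
Proof.
move=> xyz; have [v [ryv _]] : exists v, hm (right x) y v /\ hm x v z.
  by apply/(hm_assoc D); exists x; split=> //; apply: hm_right.
apply/esym/left_unique; first exact: hu_right.
by have e := hm_unitl_eq (hu_right D x) ryv; rewrite e in ryv.
Qed.

(** [hu] is closed under vertical products up to a choice of value, so [one] can
    be composed with any [p] in [hu]: all these [p] have the same top edge. *)
Lemma top_hu p : hu p -> top p = one.
Proof.
move=> pU; have [z [_ opz]] : exists z, hu z /\ vm one p z.
  by apply/vm_hu; split=> //; apply: hu_one.
apply: (@left_unique _ (transpose D)); first exact: vu_one.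
by have e := @hm_unitl_eq _ (transpose D) _ _ _ (vu_one D) opz; rewrite e in opz.
Qed.

End Edges.

Section MoreEdges.
Variables (A : finType) (D : hopf A).

Lemma bottom_hu p : hu D p -> bottom D p = one D.
Proof. exact: (@top_hu _ (reverse D)). Qed.
Lemma left_vu p : vu D p -> left D p = one D.
Proof. exact: (@top_hu _ (transpose D)). Qed.
Lemma right_vu p : vu D p -> right D p = one D.
Proof. exact: (@top_hu _ (reverse (transpose D))). Qed.
Lemma vm_match x y z : vm D x y z -> bottom D x = top D y.
Proof. exact: (@hm_match _ (transpose D)). Qed.

End MoreEdges.

(** * Squares are determined by a corner *)

Section Corner.
Variables (A : finType) (D : hopf A).
Local Notation hm := (hm D).
Local Notation vm := (vm D).
Local Notation hu := (hu D).
Local Notation vu := (vu D).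
Local Notation an := (an D).
Local Notation left := (left D).
Local Notation right := (right D).
Local Notation top := (top D).
Local Notation bottom := (bottom D).
Local Notation one := (one D).

(** The second antipode axiom yields some [a], [b], [b'] for each pair of edges.
    Here the first one shows that nothing but [a] has these edges: it applies to
    [b] above [w] and [b'] beside [w], and makes the remainder [u], for which
    [w] is [a] above [u], an identity. *)
Lemma corner_unique a b b' w :
  vm a b (top w) -> an b b' -> hm a b' (left w) -> w = a.
Proof.
move=> abw bb' ab'w.
(* [w] is [top w] above [w], that is [a] above [b] above [w]. *)
have [u [bwu auw]] : exists u, vm b w u /\ vm a u w.
  by apply/(vm_assoc D); exists (top w); split=> //; apply: vm_top.
(* Likewise [a], [b'] and [w] paste horizontally, so [b'] beside [w] exists. *)
have [v [b'wv _]] : exists v, hm b' w v /\ hm a v w.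
  by apply/(hm_assoc D); exists (left w); split=> //; apply: hm_left.
have [uV _] : vu u /\ hu v by apply/(antipodel D); exists b, w, b'.
exact: (@hm_unitr_eq _ (transpose D)) uV auw.
Qed.

Lemma corner_exists s t : vu s -> hu t -> exists w, top w = s /\ left w = t.
Proof.
move=> sV tU.
have /(antipoder D)[w [b [b' [wbs _ wb't]]]] := conj sV tU.
by exists w; rewrite -(top_vm wbs) -(left_hm wb't) top_unit // left_unit.
Qed.

Lemma corner_inverses w :
  exists b b', [/\ vm w b (top w), an b b' & hm w b' (left w)].
Proof.
have /(antipoder D)[a [b [b' [abw bb' ab'w]]]] := conj (vu_top D w) (hu_left D w).
by exists b, b'; rewrite {1 3}(corner_unique abw bb' ab'w).
Qed.

Lemma corner_inj w w' : top w = top w' -> left w = left w' -> w = w'.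
Proof.
have [b [b' [? ? ?]]] := corner_inverses w'.
by move=> et el; apply: (@corner_unique _ b b'); rewrite ?et ?el.
Qed.

(** The antipode diagram is an equality of relations, so every value of [x]
    times [x'] lies in [hu]; this excludes hypergroups, where a product with an
    inverse may take other values besides the identity. *)
Lemma hm_right_inverse x :
  exists x', forall y, hm x x' y <-> y = left x.
Proof.
have [b [x' [xb bx' xx']]] := corner_inverses x.
exists x' => y; split=> [xx'y|-> //].
have [_ yU] : vu (top x) /\ hu y by apply/(antipoder D); exists x, b, x'.
by rewrite -(left_hm xx'y) left_unit.
Qed.

End Corner.

(** * The two groupoid structures *)

Section Groupoid.
Variables (A : finType) (D : hopf A).
Local Notation hm := (hm D).
Local Notation vm := (vm D).
Local Notation hu := (hu D).
Local Notation vu := (vu D).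
Local Notation an := (an D).
Local Notation left := (left D).
Local Notation right := (right D).
Local Notation top := (top D).
Local Notation bottom := (bottom D).
Local Notation one := (one D).

Lemma hm_inverse x : exists x', (forall y, hm x x' y <-> y = left x) /\
                                (forall y, hm x' x y <-> y = right x).
Proof.
have [x' xx'] := hm_right_inverse D x.
have [x'' x''x] := hm_right_inverse (reverse D) x.
exists x'; split=> //; suff -> : x' = x'' by exact: x''x.
have lx : hm x x' (left x) by apply/xx'.
have rx : hm x'' x (right x) by apply/x''x.
have [u [x''xu ux']] : exists u, hm x'' x u /\ hm u x' x''.
  apply/(hm_assoc D); exists (left x); split=> //.
  by rewrite -(hm_match rx); apply: hm_right.
have uU : hu u by move/x''x: x''xu => ->; apply: (hu_right D).
by rewrite (hm_unitl_eq uU ux').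
Qed.


(** Associativity alone suffices, because [x'] beside [x] has one value. *)
Lemma hm_inverse_mul x y z x' : (forall t, hm x' x t <-> t = right x) ->
  (forall t, hm x x' t <-> t = left x) ->
  hm x y z -> forall t, hm x' z t <-> t = y.
Proof.
move=> x'x xx' xyz.
have half t : hm x' z t -> t = y.
  move=> x'zt; have [u [x'xu uyt]] : exists u, hm x' x u /\ hm u y t.
    by apply/(hm_assoc D); exists z.
  by apply: hm_unitl_eq uyt; move/x'x: x'xu => ->; apply: hu_right.
move=> t; split; first exact: half.
move=> ->; have [v [x'zv _]] : exists v, hm x' z v /\ hm x v z.
  apply/(hm_assoc D); exists (left x); split; first exact/xx'.
  by rewrite -(left_hm xyz); apply: hm_left.
by rewrite -(half v x'zv).
Qed.

Lemma hm_fun x y z z' : hm x y z -> hm x y z' -> z = z'.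
Proof.
have [x' [xx' x'x]] := hm_inverse x => xyz xyz'.
have x'zy : hm x' z y by apply/(hm_inverse_mul x'x xx' xyz).
have [u [xx'u uzz']] : exists u, hm x x' u /\ hm u z z'.
  by apply/(hm_assoc D); exists y.
apply/esym; apply: hm_unitl_eq uzz'; move/xx': xx'u => ->; exact: hu_left.
Qed.

Lemma hm_cancel x y y' z : hm x y z -> hm x y' z -> y = y'.
Proof.
have [x' [xx' x'x]] := hm_inverse x => xyz xy'z.
apply/(hm_inverse_mul x'x xx' xy'z); exact/(hm_inverse_mul x'x xx' xyz).
Qed.

Lemma hm_exists x y : right x = left y -> exists z, hm x y z.
Proof.
have [x' [xx' x'x]] := hm_inverse x => e.
have [z [xyz _]] : exists z, hm x y z /\ hm x' z y.
  apply/(hm_assoc D); exists (right x); split; first exact/x'x.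
  by rewrite e; apply: hm_left.
by exists z.
Qed.

End Groupoid.

Section Coordinates.
Variables (A : finType) (D : hopf A).
Local Notation hm := (hm D).
Local Notation vm := (vm D).
Local Notation hu := (hu D).
Local Notation vu := (vu D).
Local Notation left := (left D).
Local Notation right := (right D).
Local Notation top := (top D).
Local Notation bottom := (bottom D).
Local Notation one := (one D).

Lemma vm_inverse x : exists x', vm x x' (top x) /\ vm x' x (bottom x).
Proof.
have [x' [xx' x'x]] := hm_inverse (transpose D) x.
by exists x'; split; [apply/xx'|apply/x'x].
Qed.

(** The vertical inverse of [w] has top [bottom w] and a left edge inverse to
    [left w], so the corner of [w] at the lower left becomes a corner at the
    upper left. *)
Lemma left_bottom_inj w w' : left w = left w' -> bottom w = bottom w' -> w = w'.
Proof.
have [b [_ bw]] := vm_inverse w; have [b' [_ b'w']] := vm_inverse w'.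
move=> el eb; have eb' : b = b'.
  apply: (@corner_inj _ D).
    by rewrite -(top_vm bw) -(top_vm b'w') eb.
  have := left_vm b'w'; have := left_vm bw.
  rewrite !(left_vu (vu_bottom D _)) el.
  exact: (@hm_cancel _ (reverse (transpose D))).
rewrite eb' eb in bw.
exact: (@hm_cancel _ (transpose D)) bw b'w'.
Qed.

Lemma hu_inverse p : hu p -> exists q, hu q /\ vm q p one.
Proof.
move=> pU; have [q [_ qp]] := vm_inverse p.
rewrite (bottom_hu pU) in qp; exists q; split=> //.
suff [] : hu q /\ hu p by [].
by apply/(vm_hu D); exists one; split=> //; apply: hu_one.
Qed.

Lemma left_bottom_exists p n : hu p -> vu n -> exists w, left w = p /\ bottom w = n.
Proof.
move=> pU nV; have [b [bU bp]] := hu_inverse pU.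
have [w [tw lw]] := corner_exists nV bU.
have [c [wc _]] := vm_inverse w.
exists c; split; last by rewrite -(bottom_vm wc) tw bottom_unit.
have := left_vm wc; rewrite tw lw (left_vu nV) => blc.
exact: (@hm_cancel _ (transpose D)) blc bp.
Qed.

End Coordinates.

(** * Pastings and corners as total functions *)

Definition hprod A (D : hopf A) x y := odflt (one D) [pick z | hm D x y z].
Definition vprod A (D : hopf A) := hprod (transpose D).
(** The square with left edge [p] and bottom edge [n]; it encodes the exchange
    [p * n = top * right]. The primed version has top edge and right edge given.
    *)
Definition cell A (D : hopf A) p n :=
  odflt (one D) [pick x | (left D x == p) && (bottom D x == n)].
Definition cell' A (D : hopf A) := cell (transpose D).

Section Products.
Variables (A : finType) (D : hopf A).

Lemma hprodP x y : right D x = left D y -> hm D x y (hprod D x y).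
Proof.
move/hm_exists=> [z xyz]; rewrite /hprod; case: pickP => // nz.
by rewrite nz in xyz.
Qed.

Lemma hprod_eq x y z : hm D x y z -> hprod D x y = z.
Proof.
by move=> xyz; exact: hm_fun (hprodP (hm_match xyz)) xyz.
Qed.

Lemma cellP p n : hu D p -> vu D n ->
  left D (cell D p n) = p /\ bottom D (cell D p n) = n.
Proof.
move=> pU nV; rewrite /cell; case: pickP => [x /andP[/eqP-> /eqP->]//|nx].
have [w [lw bw]] := left_bottom_exists pU nV.
by have := nx w; rewrite lw bw !eqxx.
Qed.

Lemma cell_eq x : cell D (left D x) (bottom D x) = x.
Proof.
have [] := cellP (hu_left D x) (vu_bottom D x); exact: left_bottom_inj.
Qed.

End Products.

Section ProductEdges.
Variables (A : finType) (D : hopf A).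
Local Notation left := (left D).
Local Notation right := (right D).
Local Notation top := (top D).
Local Notation bottom := (bottom D).
Local Notation "x <|> y" := (hprod D x y) (at level 40, left associativity).

Lemma left_hprod x y : right x = left y -> left (x <|> y) = left x.
Proof. by move/hprodP/left_hm. Qed.
Lemma right_hprod x y : right x = left y -> right (x <|> y) = right y.
Proof. by move/hprodP/right_hm. Qed.
Lemma top_hprod x y : right x = left y -> top (x <|> y) = top x <|> top y.
Proof. by move/hprodP/top_hm/hprod_eq. Qed.
Lemma bottom_hprod x y :
  right x = left y -> bottom (x <|> y) = bottom x <|> bottom y.
Proof. by move/hprodP/bottom_hm/hprod_eq. Qed.

Lemma hprodA x y z : right x = left y -> right y = left z ->
  x <|> (y <|> z) = x <|> y <|> z.
Proof.
move=> exy eyz; have yz := hprodP eyz.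
have xyz : right x = left (y <|> z) by rewrite left_hprod.
have [u [xyu uz]] : exists u, hm D x y u /\ hm D u z (x <|> (y <|> z)).
  by apply/(hm_assoc D); exists (y <|> z); split=> //; apply: hprodP.
by rewrite (hprod_eq xyu) (hprod_eq uz).
Qed.

Lemma hprod_left x : left x <|> x = x.
Proof. exact/hprod_eq/hm_left. Qed.
Lemma hprod_right x : x <|> right x = x.
Proof. exact/hprod_eq/hm_right. Qed.

Lemma vu_hprod x y : vu D x -> vu D y -> vu D (x <|> y).
Proof.
move=> xV yV; have /(hm_vu D)[z [zV xyz]] := conj xV yV.
by rewrite (hprod_eq xyz).
Qed.

Lemma hprod_one x : vu D x -> x <|> one D = x.
Proof. by move=> xV; rewrite -(right_vu xV) hprod_right. Qed.
Lemma one_hprod x : vu D x -> one D <|> x = x.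
Proof. by move=> xV; rewrite -(left_vu xV) hprod_left. Qed.

End ProductEdges.

(** * The Zappa-Szep product *)

Section Group.
Variables (A : finType) (D : hopf A).
Local Notation hu := (hu D).
Local Notation vu := (vu D).
Local Notation left := (left D).
Local Notation right := (right D).
Local Notation top := (top D).
Local Notation bottom := (bottom D).
Local Notation one := (one D).
Local Notation cell := (cell D).
Local Notation cell' := (cell' D).
Local Notation "x <|> y" := (hprod D x y) (at level 40, left associativity).
Local Notation "x </> y" := (vprod D x y) (at level 40, left associativity).

Lemma top_vprod x y : bottom x = top y -> top (x </> y) = top x.
Proof. exact: (@left_hprod _ (transpose D)). Qed.
Lemma bottom_vprod x y : bottom x = top y -> bottom (x </> y) = bottom y.
Proof. exact: (@right_hprod _ (transpose D)). Qed.
Lemma left_vprod x y : bottom x = top y -> left (x </> y) = left x </> left y.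
Proof. exact: (@top_hprod _ (transpose D)). Qed.
Lemma right_vprod x y :
  bottom x = top y -> right (x </> y) = right x </> right y.
Proof. exact: (@bottom_hprod _ (transpose D)). Qed.
Lemma vprodA x y z : bottom x = top y -> bottom y = top z ->
  x </> (y </> z) = x </> y </> z.
Proof. exact: (@hprodA _ (transpose D)). Qed.
Lemma hu_vprod x y : hu x -> hu y -> hu (x </> y).
Proof. exact: (@vu_hprod _ (transpose D)). Qed.
Lemma vprod_one x : hu x -> x </> one = x.
Proof. exact: (@hprod_one _ (transpose D)). Qed.
Lemma one_vprod x : hu x -> one </> x = x.
Proof. exact: (@one_hprod _ (transpose D)). Qed.
Lemma vprodP x y : bottom x = top y -> vm D x y (x </> y).
Proof. exact: (@hprodP _ (transpose D)). Qed.
Lemma vprod_eq x y z : vm D x y z -> x </> y = z.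
Proof. exact: (@hprod_eq _ (transpose D)). Qed.

Lemma left_cell p n : hu p -> vu n -> left (cell p n) = p.
Proof. by move=> pU nV; case: (cellP pU nV). Qed.
Lemma bottom_cell p n : hu p -> vu n -> bottom (cell p n) = n.
Proof. by move=> pU nV; case: (cellP pU nV). Qed.
Lemma top_cell' n p : vu n -> hu p -> top (cell' n p) = n.
Proof. by move=> nV pU; case: (@cellP _ (transpose D) n p nV pU). Qed.
Lemma right_cell' n p : vu n -> hu p -> right (cell' n p) = p.
Proof. by move=> nV pU; case: (@cellP _ (transpose D) n p nV pU). Qed.
Lemma top_right_inj x y : top x = top y -> right x = right y -> x = y.
Proof. exact: (@left_bottom_inj _ (transpose D)). Qed.

Lemma cell_one_l n : vu n -> cell one n = n.
Proof. by move=> nV; rewrite -(left_vu nV) -{2}(bottom_unit nV) cell_eq. Qed.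
Lemma cell_one_r p : hu p -> cell p one = p.
Proof. by move=> pU; rewrite -(bottom_hu pU) -{1}(left_unit pU) cell_eq. Qed.

(** With [cell_hprod], these are the axioms of a matched pair: the top edge of
    [cell p n] is the action of [p] on [n], its right edge that of [n] on [p]. *)
Lemma cell_vprod p q n : hu p -> hu q -> vu n ->
  cell (p </> q) n = cell p (top (cell q n)) </> cell q n.
Proof.
move=> pU qU nV; set c := cell q n; set d := cell p (top c).
have dc : bottom d = top c by rewrite bottom_cell // vu_top.
rewrite -[RHS](cell_eq D) left_vprod // bottom_vprod //.
by rewrite bottom_cell // !left_cell // vu_top.
Qed.

Lemma cell_hprod p n k : hu p -> vu n -> vu k ->
  cell p (n <|> k) = cell p n <|> cell (right (cell p n)) k.
Proof.
move=> pU nV kV; set c := cell p n; set d := cell (right c) k.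
have dc : right c = left d by rewrite left_cell // hu_right.
rewrite -[RHS](cell_eq D) left_hprod // bottom_hprod //.
by rewrite !bottom_cell // ?left_cell // hu_right.
Qed.

(** The product is computed in the coordinates [x = top x * right x], moving
    [top y] across [right x]: it is the total pasting of a two by two array with
    [x] and [y] on the diagonal. *)
Definition mul x y :=
  let c := cell (right x) (top y) in cell' (top x <|> top c) (right c </> right y).

Lemma top_mul x y : top (mul x y) = top x <|> top (cell (right x) (top y)).
Proof.
by apply: top_cell'; [apply: vu_hprod|apply: hu_vprod]; rewrite ?vu_top ?hu_right.
Qed.

Lemma right_mul x y : right (mul x y) = right (cell (right x) (top y)) </> right y.
Proof.
by apply: right_cell'; [apply: vu_hprod|apply: hu_vprod];
  rewrite ?vu_top ?hu_right.
Qed.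

Lemma mulA : associative mul.
Proof.
move=> x y z; have hr := hu_right D; have vt := vu_top D.
set c := cell (right x) (top y); set d := cell (right y) (top z).
have bv v w : vu v -> vu w -> right v = left w by move=> *; rewrite right_vu ?left_vu.
have bh v w : hu v -> hu w -> bottom v = top w.
  by move=> *; rewrite bottom_hu ?top_hu.
(* [c], [d], [f] fill the array with diagonal [x], [y], [z] above the diagonal. *)
set f := cell (right c) (top d).
have cf : right c = left f by rewrite left_cell.
have fd : bottom f = top d by rewrite bottom_cell.
apply: top_right_inj.
  rewrite !top_mul right_mul -/c -/d cell_vprod // -/d -/f.
  rewrite cell_hprod // -/c -/f top_hprod // top_vprod //.
  by rewrite hprodA //; apply: bv.
rewrite !right_mul top_mul -/c -/d cell_hprod // -/c -/f.
rewrite cell_vprod // -/d -/f right_hprod // right_vprod //.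
by rewrite vprodA //; apply: bh.
Qed.

Lemma mul1 : left_id one mul.
Proof.
move=> x; have oU := hu_one D; have oV := vu_one D.
apply: top_right_inj; rewrite ?top_mul ?right_mul (right_unit oU) cell_one_l ?vu_top //.
  by rewrite (top_unit oV) (top_unit (vu_top D x)) one_hprod ?vu_top.
by rewrite (right_vu (vu_top D x)) one_vprod ?hu_right.
Qed.

Lemma mulr1 : right_id one mul.
Proof.
move=> x; have oU := hu_one D; have oV := vu_one D.
apply: top_right_inj; rewrite ?top_mul ?right_mul (top_unit oV) cell_one_r ?hu_right //.
  by rewrite (top_hu (hu_right D x)) hprod_one ?vu_top.
by rewrite (right_unit oU) (right_unit (hu_right D x)) vprod_one ?hu_right.
Qed.

End Group.

Section Factorization.
Variables (A : finType) (D : hopf A).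
Local Notation hu := (hu D).
Local Notation vu := (vu D).
Local Notation left := (left D).
Local Notation right := (right D).
Local Notation top := (top D).
Local Notation bottom := (bottom D).
Local Notation one := (one D).
Local Notation cell := (cell D).
Local Notation mul := (mul D).
Local Notation "x <|> y" := (hprod D x y) (at level 40, left associativity).
Local Notation "x </> y" := (vprod D x y) (at level 40, left associativity).

Lemma mul_hu_vu p n : hu p -> vu n -> mul p n = cell p n.
Proof.
move=> pU nV; apply: (@top_right_inj _ D); rewrite ?top_mul ?right_mul.
  by rewrite (right_unit pU) (top_unit nV) (top_hu pU) one_hprod ?vu_top.
by rewrite (right_unit pU) (top_unit nV) (right_vu nV) vprod_one ?hu_right.
Qed.

Lemma mul_left_bottom x : mul (left x) (bottom x) = x.
Proof. by rewrite mul_hu_vu ?cell_eq ?hu_left ?vu_bottom. Qed.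

Lemma top_right_mul n p : vu n -> hu p -> top (mul n p) = n /\ right (mul n p) = p.
Proof.
move=> nV pU; rewrite top_mul right_mul (right_vu nV) (top_hu pU).
rewrite cell_one_l ?vu_one // (top_unit (vu_one D)) (right_unit (hu_one D)).
by rewrite hprod_one ?top_unit // one_vprod ?right_unit.
Qed.

Lemma mul_top_right x : mul (top x) (right x) = x.
Proof.
by have [] := top_right_mul (vu_top D x) (hu_right D x); apply: (@top_right_inj _ D).
Qed.

Lemma mul_vu n k : vu n -> vu k -> mul n k = n <|> k.
Proof.
move=> nV kV; have nk := vu_hprod nV kV.
apply: (@top_right_inj _ D); rewrite ?top_mul ?right_mul (right_vu nV) (top_unit kV).
  by rewrite (cell_one_l kV) (top_unit nk) (top_unit kV) (top_unit nV).
by rewrite (cell_one_l kV) (right_vu kV) (right_vu nk) vprod_one ?hu_one.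
Qed.

Lemma mul_hu p q : hu p -> hu q -> mul p q = p </> q.
Proof.
move=> pU qU; have pq := hu_vprod pU qU.
apply: (@top_right_inj _ D); rewrite ?top_mul ?right_mul (right_unit pU) (top_hu qU).
  by rewrite (cell_one_r pU) (top_hu pU) (top_hu pq) hprod_one ?vu_one.
by rewrite (cell_one_r pU) (right_unit pU) (right_unit qU) (right_unit pq).
Qed.

Lemma hprod_mul x y : right x = left y -> x <|> y = mul (top x) y.
Proof.
move=> xy; rewrite -[LHS]mul_top_right top_hprod // right_hprod //.
by rewrite -mul_vu ?vu_top // -mulA mul_top_right.
Qed.

Lemma vprod_mul x y : bottom x = top y -> x </> y = mul (left x) y.
Proof.
move=> xy; rewrite -[LHS]mul_left_bottom left_vprod // bottom_vprod //.
by rewrite -mul_hu ?hu_left // -mulA mul_left_bottom.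
Qed.

Lemma hmE x y z : hm D x y z <-> right x = left y /\ z = mul (top x) y.
Proof.
split=> [xyz|[xy ->]]; last by rewrite -hprod_mul //; apply: hprodP.
have xy := hm_match xyz.
by split=> //; rewrite -hprod_mul // (hprod_eq xyz).
Qed.

Lemma vmE x y z : vm D x y z <-> bottom x = top y /\ z = mul (left x) y.
Proof.
split=> [xyz|[xy ->]]; last by rewrite -vprod_mul //; apply: vprodP.
have xy := vm_match xyz.
by split=> //; rewrite -vprod_mul // (vprod_eq xyz).
Qed.

(** The square pasted from [a] and [c] has left edge [left a] and bottom edge
    [one], so it is the identity [left a], whose right edge cancels
    [right b]. *)
Lemma mul_eq_one a b :
  bottom a <|> top b = one -> left a </> right b = one -> mul a b = one.
Proof.
move=> ab ab'; set c := cell (right a) (top b).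
have ac : right a = left c by rewrite left_cell ?hu_right ?vu_top.
have e : a <|> c = left a.
  rewrite -[LHS](cell_eq D) left_hprod // bottom_hprod //.
  by rewrite bottom_cell ?hu_right ?vu_top // ab cell_one_r ?hu_left.
apply: (@top_right_inj _ D); rewrite ?top_mul ?right_mul -/c.
  rewrite -top_hprod // e (top_hu (hu_left D a)).
  by rewrite (top_unit (vu_one D)).
by rewrite -(right_hprod ac) e (right_unit (hu_left D a)) ab' right_unit ?hu_one.
Qed.

End Factorization.

(** * The antipode *)

Section Antipode.
Variables (A : finType) (D : hopf A).
Local Notation hm := (hm D).
Local Notation vm := (vm D).
Local Notation hu := (hu D).
Local Notation vu := (vu D).
Local Notation an := (an D).
Local Notation left := (left D).
Local Notation right := (right D).
Local Notation top := (top D).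
Local Notation bottom := (bottom D).
Local Notation one := (one D).

Lemma hm_one_sym n k : vu n -> vu k -> hm n k one -> hm k n one.
Proof.
move=> nV kV nk; have [n' [nn' n'n]] := hm_inverse D n.
have nn : hm n n' one by rewrite -(left_vu nV); apply/nn'.
rewrite (hm_cancel nk nn) -(right_vu nV); exact/n'n.
Qed.

(** The first antipode axiom needs a square [b] that can be placed both below [a]
    and to the right of [a']; it exists because upper left corners are
    arbitrary. *)
Lemma an_edges a a' : an a a' ->
  vm (right a) (left a') one /\ hm (bottom a') (top a) one.
Proof.
move=> aa'; have [b [tb lb]] := corner_exists (vu_bottom D a) (hu_right D a').
have [x abx] : exists x, vm a b x by apply: (@hm_exists _ (transpose D)).
have [y a'by] : exists y, hm a' b y by apply: hm_exists.
have [xV yU] : vu x /\ hu y by apply/(antipodel D); exists a, b, a'.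
have := right_vm abx; have := bottom_hm a'by.
rewrite (right_vu xV) (bottom_hu yU).
rewrite -(right_hm a'by) (right_unit yU) -{1}(left_unit yU) (left_hm a'by).
by rewrite -(bottom_vm abx) (bottom_unit xV) -{1}(top_unit xV) (top_vm abx).
Qed.

(** The antipode axioms relate the vertical inverse of any square to something, and
    [a] is the vertical inverse of the square whose top edge is [bottom a] and
    whose left edge is inverse to [left a]. *)
Lemma an_total a : exists a', an a a'.
Proof.
have [q [qU qa]] := hu_inverse (hu_left D a).
have [w [tw lw]] := corner_exists (vu_bottom D a) qU.
have [b [b' [_ ab wb']]] := corner_inverses (transpose D) w.
have {}wb' : vm w b' (bottom a) by rewrite -tw; exact: wb'.
exists b; suff <- : b' = a by [].
apply: (@left_bottom_inj _ D).
  have := left_vm wb'; rewrite lw (left_vu (vu_bottom D a)) => qb'.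
  exact: (@hm_cancel _ (transpose D)) qb' qa.
by rewrite -(bottom_vm wb') bottom_unit ?vu_bottom.
Qed.

End Antipode.

Section Inverse.
Variables (A : finType) (D : hopf A).

Lemma an_mul a a' : an D a a' -> mul D a' a = one D /\ mul D a a' = one D.
Proof.
move=> aa'; have [v1 h1] := an_edges aa'.
have [v2 h2] := @an_edges _ (reverse D) _ _ aa'.
split; apply: mul_eq_one.
- exact: hprod_eq.
- apply: vprod_eq; apply: (@hm_one_sym _ (transpose D)) v1; [exact: hu_right|exact: hu_left].
- exact: hprod_eq h2.
- apply: vprod_eq; apply: (@hm_one_sym _ (transpose D)) v2; [exact: hu_right|exact: hu_left].
Qed.

Definition inv a := odflt (one D) [pick b | an D a b].

Lemma an_inv a : an D a (inv a).
Proof.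
rewrite /inv; case: pickP => // na; have [b ab] := an_total D a.
by rewrite na in ab.
Qed.

Lemma mulV : left_inverse (one D) inv (mul D).
Proof. by move=> a; case: (an_mul (an_inv a)). Qed.
Lemma mulrV : right_inverse (one D) inv (mul D).
Proof. by move=> a; case: (an_mul (an_inv a)). Qed.

Lemma anE a b : an D a b = (b == inv a).
Proof.
apply/idP/eqP=> [ab|->]; last exact: an_inv.
have [ba _] := an_mul ab.
by rewrite -[LHS](mulr1 D) -(mulrV a) (mulA D) ba mul1.
Qed.

Definition law : group_structure A :=
  isGroup.Build A (mulA D) (mul1 D) (mulr1 D) mulV mulrV.

End Inverse.

(** * Elementwise form of the axioms *)

Section Elements.
Local Open Scope corr_scope.
Variables X Y Z X' Y' : finType.

Lemma compP (F : corr X Y) (H : corr Y Z) x z :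
  reflect (exists y, (x, y) \in F /\ (y, z) \in H) ((x, z) \in F ;; H).
Proof.
rewrite inE; apply: (iffP existsP) => [[y /andP[? ?]]|[y [Fxy Hyz]]];
  by exists y => //; apply/andP.
Qed.

Lemma in_tensor (F : corr X Y) (H : corr X' Y') p q :
  ((p, q) \in F ** H) = ((p.1, q.1) \in F) && ((p.2, q.2) \in H).
Proof. by rewrite inE. Qed.

Lemma in_graph (f : X -> Y) x y : ((x, y) \in corr_graph f) = (y == f x).
Proof. by rewrite inE. Qed.

Lemma in_id x y : ((x, y) \in corr_id X) = (x == y).
Proof. by rewrite inE. Qed.

Lemma corr_eq_iff (F H : corr X Y) x y : F = H -> (x, y) \in F <-> (x, y) \in H.
Proof. by move=> ->. Qed.

Lemma graph_compP (f : X -> Y) (H : corr Y Z) x z :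
  ((x, z) \in corr_graph f ;; H) = ((f x, z) \in H).
Proof.
apply/compP/idP => [[y []]|fxz]; first by rewrite in_graph => /eqP->.
by exists (f x); rewrite in_graph.
Qed.

End Elements.

Section FromCorrespondences.
Local Open Scope corr_scope.
Variables (G : finType) (m : corr (G * G)%type G) (e : corr unit G)
  (Delta : corr G (G * G)%type) (eps : corr G unit) (S : corr G G).

Let corrE := (in_tensor, in_graph, in_id).

Lemma alg_assocP x y z w : (m ** corr_id G) ;; m = corr_assoc G G G ;; (corr_id G ** m) ;; m ->
  (exists u, ((x, y), u) \in m /\ ((u, z), w) \in m) <->
  (exists v, ((y, z), v) \in m /\ ((x, v), w) \in m).
Proof.
move=> /(corr_eq_iff (x, y, z) w) E; split.
  move=> [u [xyu uzw]].
  have /E/compP[[x' v] []] : (x, y, z, w) \in (m ** corr_id G) ;; m.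
    by apply/compP; exists (u, z); rewrite !corrE /= xyu eqxx.
  rewrite graph_compP !corrE /= => /andP[/eqP<- yzv] xvw.
  by exists v.
move=> [v [yzv xvw]].
have /E/compP[[u z'] []] : (x, y, z, w) \in corr_assoc G G G ;; (corr_id G ** m) ;; m.
  by apply/compP; exists (x, v); rewrite graph_compP !corrE /= yzv eqxx.
rewrite !corrE /= => /andP[xyu /eqP<-] uzw.
by exists u.
Qed.

Lemma coalg_assocP x y z w :
  Delta ;; (Delta ** corr_id G) ;; corr_assoc G G G = Delta ;; (corr_id G ** Delta) ->
  (exists u, (u, (x, y)) \in Delta /\ (w, (u, z)) \in Delta) <->
  (exists v, (v, (y, z)) \in Delta /\ (w, (x, v)) \in Delta).
Proof.
move=> /(corr_eq_iff w (x, (y, z))) E; split.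
  move=> [u [xyu uzw]].
  have /E/compP[[x' v] [xvw]] :
      (w, (x, (y, z))) \in Delta ;; (Delta ** corr_id G) ;; corr_assoc G G G.
    apply/compP; exists (x, y, z); rewrite in_graph eqxx; split=> //.
    by apply/compP; exists (u, z); rewrite !corrE /= xyu eqxx.
  rewrite !corrE /= => /andP[/eqP ex yzv].
  by exists v; rewrite -ex.
move=> [v [yzv xvw]].
have /E/compP[[[x' y'] z'] [/compP[[u z''] [uzw]]]] :
    (w, (x, (y, z))) \in Delta ;; (corr_id G ** Delta).
  by apply/compP; exists (x, v); rewrite !corrE /= yzv eqxx.
rewrite !corrE /= => /andP[xyu /eqP ez] /eqP[-> -> ->].
by exists u; rewrite -ez.
Qed.

Lemma unitlP x y : (e ** corr_id G) ;; m = corr_unitl G ->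
  (exists u, (tt, u) \in e /\ ((u, x), y) \in m) <-> x = y.
Proof.
move=> /setP/(_ (tt, x, y)) E; split=> [[u [eu uxy]]|xy].
  suff: (tt, x, y) \in corr_unitl G by rewrite in_graph => /eqP.
  rewrite -E.
  by apply/compP; exists (u, x); rewrite !corrE /= eu eqxx.
have: (tt, x, y) \in corr_unitl G by rewrite in_graph xy.
rewrite -E => /compP[[u x'] []].
by rewrite !corrE /= => /andP[eu /eqP<-] uxy; exists u.
Qed.

Lemma unitrP x y : (corr_id G ** e) ;; m = corr_unitr G ->
  (exists u, (tt, u) \in e /\ ((x, u), y) \in m) <-> x = y.
Proof.
move=> /setP/(_ (x, tt, y)) E; split=> [[u [eu uxy]]|xy].
  suff: (x, tt, y) \in corr_unitr G by rewrite in_graph => /eqP.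
  rewrite -E.
  by apply/compP; exists (x, u); rewrite !corrE /= eu eqxx.
have: (x, tt, y) \in corr_unitr G by rewrite in_graph xy.
rewrite -E => /compP[[x' u] []].
by rewrite !corrE /= => /andP[/eqP<- eu] uxy; exists u.
Qed.

Lemma counitlP x y : Delta ;; (eps ** corr_id G) = corr_unitl_inv G ->
  (exists u, (u, tt) \in eps /\ (y, (u, x)) \in Delta) <-> x = y.
Proof.
move=> /setP/(_ (y, (tt, x))) E; split=> [[u [eu uxy]]|xy].
  suff: (y, (tt, x)) \in corr_unitl_inv G by rewrite in_graph => /eqP[].
  rewrite -E.
  by apply/compP; exists (u, x); rewrite !corrE /= eu eqxx.
have: (y, (tt, x)) \in corr_unitl_inv G by rewrite in_graph xy.
rewrite -E => /compP[[u x'] []].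
by rewrite !corrE /= => uxy /andP[eu /eqP<-]; exists u.
Qed.

Lemma counitrP x y : Delta ;; (corr_id G ** eps) = corr_unitr_inv G ->
  (exists u, (u, tt) \in eps /\ (y, (x, u)) \in Delta) <-> x = y.
Proof.
move=> /setP/(_ (y, (x, tt))) E; split=> [[u [eu uxy]]|xy].
  suff: (y, (x, tt)) \in corr_unitr_inv G by rewrite in_graph => /eqP[].
  rewrite -E.
  by apply/compP; exists (x, u); rewrite !corrE /= eu eqxx.
have: (y, (x, tt)) \in corr_unitr_inv G by rewrite in_graph xy.
rewrite -E => /compP[[x' u] []].
by rewrite !corrE /= => uxy /andP[/eqP<- eu]; exists u.
Qed.

Lemma comul_mulP x y p q : m ;; Delta = (Delta ** Delta) ;; corr_tensor_mul m m ->
  (exists z, ((x, y), z) \in m /\ (z, (p, q)) \in Delta) <->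
  (exists x1 x2 y1 y2, [/\ (x, (x1, x2)) \in Delta, (y, (y1, y2)) \in Delta,
     ((x1, y1), p) \in m & ((x2, y2), q) \in m]).
Proof.
move=> /(corr_eq_iff (x, y) (p, q)) E; split.
  case/compP/E/compP=> [[[x1 x2] [y1 y2]] []]; rewrite graph_compP !corrE /=.
  by move=> /andP[? ?] /andP[? ?]; exists x1, x2, y1, y2.
move=> [x1 [x2 [y1 [y2 [? ? ? ?]]]]]; apply/compP/E/compP.
exists ((x1, x2), (y1, y2)); rewrite graph_compP !corrE /=.
by split; apply/andP.
Qed.

Lemma comul_oneP p q : e ;; Delta = corr_tensor_one e e ->
  (exists z, (tt, z) \in e /\ (z, (p, q)) \in Delta) <->
  (tt, p) \in e /\ (tt, q) \in e.
Proof.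
move=> /setP/(_ (tt, (p, q))); rewrite graph_compP in_tensor /= => E; split.
  by move=> /compP; rewrite E => /andP.
by move/andP; rewrite -E => /compP.
Qed.

Lemma counit_mulP x y : m ;; eps = (eps ** eps) ;; corr_unit_mul ->
  (exists z, (z, tt) \in eps /\ ((x, y), z) \in m) <->
  (x, tt) \in eps /\ (y, tt) \in eps.
Proof.
move=> /(corr_eq_iff (x, y) tt) E; split.
  move=> [z [ez xyz]].
  have /E/compP[[[] []] []] : ((x, y), tt) \in m ;; eps by apply/compP; exists z.
  by rewrite in_tensor => /andP[].
move=> [ex ey].
have /E/compP[z []] : ((x, y), tt) \in (eps ** eps) ;; corr_unit_mul.
  by apply/compP; exists (tt, tt); rewrite in_tensor in_graph /= ex ey.
by exists z.
Qed.

Lemma counit_oneP : e ;; eps = corr_unit_one ->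
  exists u, (tt, u) \in e /\ (u, tt) \in eps.
Proof. by move=> /(corr_eq_iff tt tt) E; apply/compP/E; rewrite in_id. Qed.

Lemma counit_unitP x y : (x, y) \in eps ;; e <-> (x, tt) \in eps /\ (tt, y) \in e.
Proof. by split=> [/compP[[]]|ee] //; apply/compP; exists tt. Qed.

Lemma antipodelP x y : Delta ;; (S ** corr_id G) ;; m = eps ;; e ->
  (exists a b a', [/\ (x, (a, b)) \in Delta, (a, a') \in S & ((a', b), y) \in m])
  <-> (x, tt) \in eps /\ (tt, y) \in e.
Proof.
move=> E; split.
  move=> [a [b [a' [xab aa' a'by]]]]; apply/counit_unitP; rewrite -E.
  apply/compP; exists (a', b); split=> //.
  by apply/compP; exists (a, b); rewrite !corrE /= aa' eqxx.
move/counit_unitP; rewrite -E => /compP[[a' b'] [/compP[[a b] [xab]]]].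
by rewrite !corrE /= => /andP[aa' /eqP<-] a'by; exists a, b, a'.
Qed.

Lemma antipoderP x y : Delta ;; (corr_id G ** S) ;; m = eps ;; e ->
  (exists a b b', [/\ (x, (a, b)) \in Delta, (b, b') \in S & ((a, b'), y) \in m])
  <-> (x, tt) \in eps /\ (tt, y) \in e.
Proof.
move=> E; split.
  move=> [a [b [b' [xab bb' ab'y]]]]; apply/counit_unitP; rewrite -E.
  apply/compP; exists (a, b'); split=> //.
  by apply/compP; exists (a, b); rewrite !corrE /= bb' eqxx.
move/counit_unitP; rewrite -E => /compP[[a' b'] [/compP[[a b] [xab]]]].
by rewrite !corrE /= => /andP[/eqP<- bb'] ab'y; exists a, b, b'.
Qed.

Lemma hopf_of_corr : is_corr_hopf_algebra m e Delta eps S ->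
  exists D : hopf G,
    [/\ (forall x y z, ((x, y), z) \in m = hm D x y z),
        (forall x y z, (z, (x, y)) \in Delta = vm D x y z),
        (forall x, ((tt, x) \in e) = hu D x),
        (forall x, ((x, tt) \in eps) = vu D x)
      & forall x y, (x, y) \in S = an D x y].
Proof.
case=> [[[A1 A2 A3] [C1 C2 C3] [B1 B2] [B3 /counit_oneP[o [eo oe]]]] [S1 S2]].
unshelve eexists (@Hopf G (fun x y z => ((x, y), z) \in m)
  (fun x y z => (z, (x, y)) \in Delta) (fun x => (tt, x) \in e)
  (fun x => (x, tt) \in eps) (fun x y => (x, y) \in S) o _ _ _ _ _ _ _ _ _ eo oe _ _).
- by move=> x y z w; apply: alg_assocP.
- by move=> x y z w; apply: coalg_assocP.
- by move=> x y; apply: unitlP.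
- by move=> x y; apply: unitrP.
- by move=> x y; apply: counitlP.
- by move=> x y; apply: counitrP.
- by move=> x y p q; apply: comul_mulP.
- by move=> p q; apply: comul_oneP.
- by move=> x y; apply: counit_mulP.
- by move=> x y; apply: antipodelP.
- by move=> x y; apply: antipoderP.
by [].
Qed.

End FromCorrespondences.

(** * The factorization *)

Section Subgroups.
Variables (G : finType) (D : hopf G).
Local Notation gT := (finGroup_of (law D)).

Lemma mulE (x y : gT) : (x * y)%g = mul D x y.
Proof. by []. Qed.

Lemma group_set_hu : group_set [set x : gT | hu D x].
Proof.
apply/group_setP; split; first by rewrite inE; apply: (hu_one D).
move=> x y; rewrite !inE => xU yU.
by rewrite mulE mul_hu //; apply: hu_vprod.
Qed.

Lemma group_set_vu : group_set [set x : gT | vu D x].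
Proof.
apply/group_setP; split; first by rewrite inE; apply: (vu_one D).
move=> x y; rewrite !inE => xU yU.
by rewrite mulE mul_vu //; apply: vu_hprod.
Qed.

Definition Gplus : {group gT} := Group group_set_hu.
Definition Gminus : {group gT} := Group group_set_vu.

Lemma in_Gplus (x : gT) : (x \in Gplus) = hu D x.
Proof. by rewrite [LHS]inE. Qed.

Lemma in_Gminus (x : gT) : (x \in Gminus) = vu D x.
Proof. by rewrite [LHS]inE. Qed.

Lemma unique_factorization_Gplus : unique_factorization Gplus Gminus.
Proof.
move=> g; exists (left D g, bottom D g); split=> /=.
  by rewrite in_Gplus in_Gminus hu_left vu_bottom mulE mul_left_bottom.
case=> p n /= []; rewrite in_Gplus in_Gminus => pU nV ->.
by rewrite mulE mul_hu_vu // left_cell // bottom_cell.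
Qed.

End Subgroups.

Theorem theorem3 (G : finType)
    (m : corr (G * G)%type G) (e : corr unit G)
    (Delta : corr G (G * G)%type) (eps : corr G unit) (S : corr G G)
    (hopfG : is_corr_hopf_algebra m e Delta eps S) :
  exists (law : group_structure G) (Gp Gm : {group finGroup_of law}),
    [/\ unique_factorization Gp Gm,
        m = [set t : (G * G) * G |
              [exists gm in Gm, [exists hp in Gp, [exists km in Gm,
                t == ((gm * hp, hp * km), gm * hp * km)%g]]]],
        Delta = [set t : G * (G * G) |
              [exists gp in Gp, [exists hm in Gm, [exists kp in Gp,
                t == (gp * hm * kp, (gp * hm, hm * kp))%g]]]]
      & [/\ e = [set (tt, gp : G) | gp in Gp],
            eps = [set (gm : G, tt) | gm in Gm]
          & S = [set (g : G, (g^-1)%g : G) | g : finGroup_of law]]].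
Proof.
have [D [mE DE eE epsE SE]] := hopf_of_corr hopfG.
exists (law D), (Gplus D), (Gminus D); split; first exact: unique_factorization_Gplus.
- apply/setP=> -[[x y] z]; rewrite inE mE; apply/idP/idP.
    move/hmE=> [xy ->].
    apply/exists_inP; exists (top D x); first by rewrite in_Gminus vu_top.
    apply/exists_inP; exists (right D x); first by rewrite in_Gplus hu_right.
    apply/exists_inP; exists (bottom D y); first by rewrite in_Gminus vu_bottom.
    have e2 : mul D (top D x) y = mul D x (bottom D y).
      by rewrite -{1}(mul_left_bottom D y) mulA -xy mul_top_right.
    by apply/eqP; rewrite !mulE mul_top_right xy mul_left_bottom e2.
  case/exists_inP=> n; rewrite in_Gminus => nV; case/exists_inP=> p; rewrite in_Gplus => pU.
  case/exists_inP=> k; rewrite in_Gminus => kV /eqP[-> -> ->]; rewrite !mulE.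
  have [tn rp] := top_right_mul nV pU.
  apply/hmE; rewrite tn rp (mul_hu_vu pU kV) (left_cell pU kV).
  by rewrite -mulA (mul_hu_vu pU kV).
- apply/setP=> -[z [x y]]; rewrite inE DE; apply/idP/idP.
    move/vmE=> [xy ->].
    apply/exists_inP; exists (left D x); first by rewrite in_Gplus hu_left.
    apply/exists_inP; exists (bottom D x); first by rewrite in_Gminus vu_bottom.
    apply/exists_inP; exists (right D y); first by rewrite in_Gplus hu_right.
    have e2 : mul D (left D x) y = mul D x (right D y).
      by rewrite -{1}(mul_top_right D y) mulA -xy mul_left_bottom.
    by apply/eqP; rewrite !mulE mul_left_bottom xy mul_top_right e2.
  case/exists_inP=> p; rewrite in_Gplus => pU; case/exists_inP=> n; rewrite in_Gminus => nV.
  case/exists_inP=> q; rewrite in_Gplus => qU /eqP[-> -> ->]; rewrite !mulE.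
  have [tn rq] := top_right_mul nV qU.
  apply/vmE; rewrite tn (mul_hu_vu pU nV) (left_cell pU nV) (bottom_cell pU nV).
  by rewrite -(mul_hu_vu pU nV) -mulA.
split.
- apply/setP=> -[[] x]; rewrite eE; apply/idP/imsetP => [xU|[y]].
    by exists x; rewrite ?in_Gplus.
  by rewrite in_Gplus => yU [->].
- apply/setP=> -[x []]; rewrite epsE; apply/idP/imsetP => [xU|[y]].
    by exists x; rewrite ?in_Gminus.
  by rewrite in_Gminus => yU [->].
apply/setP=> -[x y]; rewrite SE anE; apply/eqP/imsetP => [->|[z _ [-> ->]]].
  by exists x.
by [].
Qed.
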